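(* Strong TRO equivalence is an equivalence relation (on the class of norm closed algebras of operators acting on Hilbert spaces).
   Context: A ternary ring of operators (TRO) is a linear subspace $M\subset B(H,K)$ ($H,K$ Hilbert spaces) with $MM^*M\subset M$. For a set $S$ of operators, $[S]^{-\|\cdot\|}$ is the norm closure of the linear span of $S$; products of sets denote sets of products and $M^*=\{m^*:m\in M\}$. Norm closed algebras $A\subset B(H)$ and $B\subset B(K)$ are strongly TRO equivalent if there is a TRO $M\subset B(H,K)$ with $A=[M^*BM]^{-\|\cdot\|}$ and $B=[MAM^*]^{-\|\cdot\|}$. *)

(* Defs.v *)
From HB Require Import structures.
From mathcomp Require Import all_boot all_order all_algebra.
From mathcomp Require Import complex.
From mathcomp Require Import all_classical all_reals all_analysis.

Set Implicit Arguments.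
Unset Strict Implicit.
Unset Printing Implicit Defensive.

Import Order.TTheory GRing.Theory Num.Theory.
Import numFieldNormedType.Exports.

Local Open Scope classical_set_scope.
Local Open Scope ring_scope.
Local Open Scope complex_scope.

(* The inner product is linear in its first argument and conjugate linear in
   its second one. *)
HB.mixin Record CompleteNormedModule_isHilbert (R : realType) H
    of CompleteNormedModule R[i] H := {
  inner : {dot H for @Num.conj R[i]};
  normr_inner : forall x : H, `|x| ^+ 2 = inner x x
}.

#[short(type="hilbertType")]
HB.structure Definition Hilbert (R : realType) :=
  {H of CompleteNormedModule R[i] H & CompleteNormedModule_isHilbert R H}.

Section BoundedOperators.
Context {R : realType}.
Implicit Types H K L : hilbertType R.

Definition bounded_op H K : {pred H -> K} :=
  mem [set f : H -> K | linear f /\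
    exists k : R, forall x, `|f x| <= k%:C * `|x|].

Lemma bounded_op_submod H K : submod_closed (@bounded_op H K).
Proof.
split.
  rewrite inE; split; first by move=> a x y; rewrite /= scaler0 addr0.
  by exists 0 => x; rewrite normr0 mul0r.
move=> a f g; rewrite !inE => -[flin [kf fb]] [glin [kg gb]]; split.
  move=> b x y.
  change (a *: f (b *: x + y) + g (b *: x + y) =
    b *: (a *: f x + g x) + (a *: f y + g y)).
  rewrite flin glin.
  by rewrite !scalerDr !scalerA [a * b]mulrC addrACA.
exists (Normc.normc a * kf + kg) => x.
apply: (le_trans (ler_normD _ _)).
rewrite rmorphD rmorphM mulrDl lerD// -mulrA.
by rewrite [X in X <= _]normrZ ler_wpM2l.
Qed.

HB.instance Definition _ H K :=
  GRing.isSubmodClosed.Build R[i] (H -> K) (@bounded_op H K)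
    (@bounded_op_submod H K).

Record bop H K := BOp {
  bop_fun :> H -> K ;
  _ : bop_fun \in @bounded_op H K
}.

HB.instance Definition _ H K := [isSub for @bop_fun H K].
HB.instance Definition _ H K := [Choice of bop H K by <:].
HB.instance Definition _ H K := [SubChoice_isSubLmodule of bop H K by <:].

Lemma bop_linear H K (T : bop H K) : linear T.
Proof. by have := valP T; rewrite inE => -[]. Qed.

HB.instance Definition _ H K (T : bop H K) :=
  GRing.isLinear.Build R[i] H K *:%R (bop_fun T) (@bop_linear H K T).

Lemma bop_bounded H K (T : bop H K) :
  exists k : R, forall x, `|T x| <= k%:C * `|x|.
Proof. by have := valP T; rewrite inE => -[]. Qed.

Lemma bopP H K (S T : bop H K) : S =1 T -> S = T.
Proof. by move=> ST; apply/val_inj/funext. Qed.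

Definition opnorm H K (T : bop H K) : R :=
  sup [set complex.Re `|T x| | x in [set x : H | `|x| <= 1]].

Lemma Re_le (x y : R[i]) : x <= y -> complex.Re x <= complex.Re y.
Proof. by rewrite lecE => /andP[]. Qed.

Lemma normE (V : normedModType R[i]) (x : V) : `|x| = (complex.Re `|x|)%:C.
Proof. by rewrite RRe_real// normr_real. Qed.

Lemma opnorm_has_sup H K (T : bop H K) :
  has_sup [set complex.Re `|T x| | x in [set x : H | `|x| <= 1]].
Proof.
split; first by exists (complex.Re `|T 0|), 0 => //=; rewrite normr0.
have [k Tk] := bop_bounded T.
exists `|k| => _ [x /= x1 <-].
have kR : k%:C \is Num.real by apply/complex_realP; exists k.
rewrite -lecR -normE (le_trans (Tk x))//.
apply: (@le_trans _ _ (`|k|%:C * `|x|)).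
  by rewrite ler_wpM2r// lecR ler_norm.
by rewrite ler_piMr// ler0c.
Qed.

Lemma opnorm_ge H K (T : bop H K) x :
  `|x| <= 1 -> complex.Re `|T x| <= opnorm T.
Proof. by move=> x1; apply: (sup_upper_bound (opnorm_has_sup T)); exists x. Qed.

Lemma opnorm_ge0 H K (T : bop H K) : 0 <= opnorm T.
Proof.
have := @opnorm_ge _ _ T 0; rewrite linear0 !normr0; apply.
exact: ler01.
Qed.

Lemma le_opnorm H K (T : bop H K) x : `|T x| <= (opnorm T)%:C * `|x|.
Proof.
have [->|x0] := eqVneq x 0; first by rewrite linear0 !normr0 mulr0.
have nx0 : 0 < `|x| by rewrite normr_gt0.
have := @opnorm_ge _ _ T (`|x|^-1 *: x).
rewrite linearZ !normrZ normfV normr_id mulVf ?gt_eqF// => /(_ (lexx _)).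
rewrite -lecR RRe_real ?realM ?realV ?normr_real// mulrC.
by rewrite ler_pdivrMr.
Qed.

Lemma opnorm_le H K (T : bop H K) (k : R) : 0 <= k ->
  (forall x, `|T x| <= k%:C * `|x|) -> opnorm T <= k.
Proof.
move=> k0 Tk; apply: ge_sup; first by case: (opnorm_has_sup T).
move=> _ [x /= x1 <-]; rewrite -lecR -normE (le_trans (Tk x))//.
by rewrite ler_piMr// ler0c.
Qed.

Lemma opnormD H K (S T : bop H K) :
  (opnorm (S + T))%:C <= (opnorm S)%:C + (opnorm T)%:C.
Proof.
rewrite -rmorphD lecR; apply: opnorm_le => [|x].
  by rewrite addr_ge0 ?opnorm_ge0.
rewrite (le_trans (ler_normD _ _))// rmorphD mulrDl lerD ?le_opnorm//.
Qed.

Lemma opnormZ H K (a : R[i]) (T : bop H K) :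
  (opnorm (a *: T))%:C = `|a| * (opnorm T)%:C.
Proof.
have le_Z b (S : bop H K) : (opnorm (b *: S))%:C <= `|b| * (opnorm S)%:C.
  rewrite -rmorphM lecR; apply: opnorm_le => [|x].
    by rewrite mulr_ge0 ?opnorm_ge0// -ler0c; exact: (normr_ge0 b).
  rewrite rmorphM -mulrA.
  by rewrite [X in X <= _]normrZ ler_wpM2l// le_opnorm.
apply/eqP; rewrite eq_le le_Z/=.
have [->|a0] := eqVneq a 0.
  by rewrite normr0 mul0r ler0c opnorm_ge0.
rewrite mulrC -ler_pdivlMr ?normr_gt0// mulrC -normfV.
by have := le_Z a^-1 (a *: T); rewrite scalerA mulVf// scale1r.
Qed.

Lemma opnorm_eq0 H K (T : bop H K) : (opnorm T)%:C = 0 -> T = 0.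
Proof.
move=> T0; apply: bopP => x; apply/normr0_eq0/eqP.
by rewrite eq_le normr_ge0 andbT; have := le_opnorm T x; rewrite T0 mul0r.
Qed.

(* Norms over R[i] take their values in R[i]. *)
HB.instance Definition _ H K :=
  Lmodule_isNormed.Build R[i] (bop H K) (@opnormD H K) (@opnormZ H K)
    (@opnorm_eq0 H K).

Lemma bop_comp_subproof H K L (S : bop K L) (T : bop H K) :
  S \o T \in @bounded_op H L.
Proof.
rewrite inE; split; first by move=> a x y; rewrite /= !linearP.
exists (opnorm S * opnorm T) => x; rewrite rmorphM /= -mulrA.
rewrite (le_trans (le_opnorm _ _))// ler_wpM2l ?le_opnorm//.
by rewrite ler0c opnorm_ge0.
Qed.

Definition bop_comp H K L (S : bop K L) (T : bop H K) : bop H L :=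
  BOp (bop_comp_subproof S T).

Definition is_adjoint H K (T : bop H K) (S : bop K H) :=
  forall x y, inner (T x) y = inner x (S y).

(* By the Riesz representation theorem every T : bop H K has exactly one
   adjoint, so this is the set of all T^* with T in M. *)
Definition adjoint_set H K (M : set (bop H K)) : set (bop K H) :=
  [set S | exists2 T, M T & is_adjoint T S].

Definition prod_set H K L (M : set (bop K L)) (N : set (bop H K)) :
  set (bop H L) := [set bop_comp S T | S in M & T in N].

Definition lin_span H K (S : set (bop H K)) : set (bop H K) :=
  [set T | exists n (c : 'I_n -> R[i]) (s : 'I_n -> bop H K),
    (forall i, S (s i)) /\ T = \sum_(i < n) c i *: s i].

Definition closed_span H K (S : set (bop H K)) : set (bop H K) :=
  closure (lin_span S).

Definition linear_subspace H K (M : set (bop H K)) := submod_closed [in M].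

Definition TRO H K (M : set (bop H K)) :=
  linear_subspace M /\ prod_set (prod_set M (adjoint_set M)) M `<=` M.

Definition closed_algebra H (A : set (bop H H)) :=
  [/\ linear_subspace A, prod_set A A `<=` A & closed A].

End BoundedOperators.

Record opalg (R : realType) := OpAlg {
  opalg_space : hilbertType R ;
  opalg_set :> set (bop opalg_space opalg_space) ;
  opalg_closed_algebra : closed_algebra opalg_set
}.

Definition strongly_TRO_equivalent (R : realType) (A B : opalg R) : Prop :=
  exists M : set (bop (opalg_space A) (opalg_space B)),
    [/\ TRO M,
        A = closed_span (prod_set (prod_set (adjoint_set M) B) M) :> set _ &
        B = closed_span (prod_set (prod_set M A) (adjoint_set M)) :> set _].

(* Main.v *)
Require Import Defs.
From mathcomp Require Import all_boot all_order all_algebra.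
From mathcomp Require Import complex.
From mathcomp Require Import all_classical all_reals all_analysis.
From mathcomp Require Import ring lra.

(** Write [X] for the closed span of X.  Every bounded operator T has an
adjoint T^*, so taking adjoint sets is an involution, and the two defining
equations read A = [M^* B M] and B = [M A M^*].

Reflexivity is witnessed by the scalar operators, and symmetry by M^*.

For transitivity, let M link A to B and N link B to C, so that
A = [M^* B M], B = [M A M^*] = [N^* C N] and C = [N B N^*].  The naive link N M
need not be a TRO: nothing absorbs the middle factors of
N M (N M)^* N M = N . M M^* . N^* N . M.  What helps is that both M M^* and
N^* N multiply B into itself on either side.  Let D be the set of all d such
that d and d^* are two-sided multipliers of B (multiplier_star).  It is a unital
semigroup, stable under adjoints, and contains M M^* and N^* N
(TRO_multiplier_star), so the linear span T of N D M is a TRO: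
  N D M . M^* D N^* . N D M = N . D M M^* D N^* N D . M, inside N D M.
Moreover T^* C T = M^* D (N^* C N) D M lies in the span of M^* (D B D) M, hence
in [M^* B M], while the unit of D gives M^* (N^* C N) M inside T^* C T; so
[T^* C T] = [M^* B M] = A (compress_link).  The equation C = [T A T^*] is the
same fact for the reversed chain N^*, M^*, because T^* is the span of M^* D N^*.

All inclusions between closed spans are checked on generators: the operators X
for which S X T lies in a fixed closed subspace form a closed subspace, as
multiplication by a fixed operator is linear and bounded.

Adjoints come from the Riesz representation theorem, which is proved
by minimising |x|^2 - 2 Re f(x). *)

Set Implicit Arguments.
Unset Strict Implicit.
Unset Printing Implicit Defensive.

Import Order.TTheory GRing.Theory Num.Theory.
Import numFieldNormedType.Exports.

Local Open Scope classical_set_scope.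
Local Open Scope ring_scope.
Local Open Scope complex_scope.

Local Infix "**" := bop_comp (at level 40, left associativity).

(** * Adjoints through the Riesz representation theorem *)

Lemma discriminant_le0 (R : realFieldType) (a b c : R) :
  0 <= c -> (forall t, 0 <= a + 2 * b * t + c * t ^+ 2) -> b ^+ 2 <= a * c.
Proof.
rewrite le_eqVlt => /predU1P[<- h|c0 h].
  rewrite mulr0; have [->|b0] := eqVneq b 0; first by rewrite expr0n.
  (* At this t the remaining affine function takes the value -1. *)
  have := h (- (a + 1) / (2 * b)).
  rewrite mul0r addr0 mulrC divfK; last by rewrite mulf_neq0 ?pnatr_eq0.
  by move=> ?; lra.
have := h (- b / c).
have -> : a + 2 * b * (- b / c) + c * (- b / c) ^+ 2 = (a * c - b ^+ 2) / c.
  by field; rewrite gt_eqF.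
by rewrite pmulr_lge0 ?invr_gt0// subr_ge0.
Qed.

Section RealInner.
Context {R : realType} {H : hilbertType R}.
Implicit Types x y z : H.

(** The minimisation behind the Riesz theorem only sees the underlying real
Hilbert space, so norms and inner products are first made real valued. *)
Definition reinner x y : R := complex.Re (inner x y).
Definition renorm x : R := complex.Re `|x|.

Lemma normr_renorm x : `|x| = (renorm x)%:C.
Proof. exact: normE. Qed.

Lemma renorm_ge0 x : 0 <= renorm x.
Proof. rewrite -lecR -normr_renorm; exact: normr_ge0. Qed.

Lemma innerC x y : inner y x = (inner x y)^*%C.
Proof.
by rewrite hermC /= expr0 mul1r.
Qed.

Lemma innerDl x y z : inner (x + y) z = inner x z + inner y z.
Proof. exact: linearDl. Qed.

Lemma innerZl a x y : inner (a *: x) y = a * inner x y.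
Proof. exact: linearZl_LR. Qed.

Lemma reinnerC x y : reinner x y = reinner y x.
Proof. by rewrite /reinner innerC; case: (inner y x). Qed.

Lemma reinnerDl x y z : reinner (x + y) z = reinner x z + reinner y z.
Proof. by rewrite /reinner innerDl raddfD. Qed.

Lemma reinnerZl (t : R) x y : reinner (t%:C *: x) y = t * reinner x y.
Proof.
by rewrite /reinner innerZl; case: (inner x y) => u v /=; rewrite mul0r subr0.
Qed.

Lemma reinnerDr x y z : reinner x (y + z) = reinner x y + reinner x z.
Proof. by rewrite !(reinnerC x) reinnerDl. Qed.

Lemma reinnerZr (t : R) x y : reinner x (t%:C *: y) = t * reinner x y.
Proof. by rewrite !(reinnerC x) reinnerZl. Qed.

Lemma reinnerxx x : reinner x x = renorm x ^+ 2.
Proof. by rewrite /reinner -normr_inner normr_renorm -rmorphXn. Qed.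

Lemma reinner_cauchy_schwarz_sqr x y :
  reinner x y ^+ 2 <= renorm x ^+ 2 * renorm y ^+ 2.
Proof.
apply: discriminant_le0 => [|t]; first exact: sqr_ge0.
have := sqr_ge0 (renorm (x + t%:C *: y)).
rewrite -!reinnerxx !(reinnerDl, reinnerDr, reinnerZl, reinnerZr).
by rewrite (reinnerC y x); congr (0 <= _); ring.
Qed.

Lemma reinner_cauchy_schwarz x y : reinner x y <= renorm x * renorm y.
Proof.
apply: (le_trans (ler_norm _)).
rewrite -(@ler_pXn2r _ 2)// ?nnegrE ?mulr_ge0 ?renorm_ge0//.
by rewrite real_normK ?num_real// exprMn reinner_cauchy_schwarz_sqr.
Qed.

End RealInner.

Section RealRiesz.
Context {R : realType} {H : hilbertType R} (f : H -> R) (k : R)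
  (fD : forall x y, f (x + y) = f x + f y)
  (fZ : forall (t : R) x, f (t%:C *: x) = t * f x)
  (fk : forall x, `|f x| <= k * renorm x).

Let F x : R := renorm x ^+ 2 - 2 * f x.

Let FE x y (t : R) :
  F (x + t%:C *: y) =
    F x + 2 * (reinner y x - f y) * t + renorm y ^+ 2 * t ^+ 2.
Proof.
rewrite /F -!reinnerxx !(reinnerDl, reinnerDr, reinnerZl, reinnerZr) fD fZ.
rewrite (reinnerC x y); ring.
Qed.

Let F_lb x : - k ^+ 2 <= F x.
Proof.
rewrite /F; have := fk x; rewrite ler_norml => /andP[_ fx].
have := sqr_ge0 (renorm x - k); rewrite sqrrB; lra.
Qed.

Let m := inf (range F).

Let m_le x : m <= F x.
Proof.
apply: ge_inf; last by exists x.
by exists (- k ^+ 2) => _ [y _ <-]; exact: F_lb.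
Qed.

Let m_approx (e : R) : 0 < e -> exists x, F x < m + e.
Proof.
move=> e0; have [|_ [x _ <-] xm] := @inf_adherent _ (range F) e e0.
  split; first by exists (F 0), 0.
  by exists (- k ^+ 2) => _ [y _ <-]; exact: F_lb.
by exists x.
Qed.

(** F is at least m at the midpoint of x and y; this is why
the sublevel sets of F shrink to a point near its infimum. *)
Let F_parallelogram x y (e : R) : F x < m + e -> F y < m + e ->
  renorm (x - y) ^+ 2 < 4 * e.
Proof.
move=> xe ye.
have := m_le (y + (2^-1)%:C *: (x - y)); rewrite FE => mid.
have := FE y (x - y) 1; rewrite scale1r addrC subrK => Fx.
rewrite addrC in Fx. lra.
Qed.

(** The first variation of F at an approximate minimiser is small: the
quadratic t |-> F (x + t v) stays above F x - e. *)
Let near_stationary x v (e : R) : F x < m + e ->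
  (reinner v x - f v) ^+ 2 <= e * renorm v ^+ 2.
Proof.
move=> xe; apply: discriminant_le0 => [|t]; first exact: sqr_ge0.
have := m_le (x + t%:C *: v); rewrite FE; lra.
Qed.

(** The approximate minimisers of F converge, and each of them almost
represents f, so their limit represents f. *)
Lemma real_riesz : exists z, forall x, f x = reinner x z.
Proof.
pose G := filter_from [set e : R | 0 < e] (fun e => [set x | F x < m + e]).
have GF : ProperFilter G.
  apply: filter_from_proper; last by move=> e /m_approx[x ?]; exists x.
  apply: filter_from_filter; first by exists 1 => /=.
  move=> e1 e2 e10 e20; exists (Num.min e1 e2) => /=.
    by rewrite lt_min e10.
  move=> x /= xm; split; apply: (lt_le_trans xm).
    by rewrite lerD2l ge_min lexx.
  by rewrite lerD2l ge_min lexx orbT.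
have /cauchy_cvgP/cvg_ex[z Gz] : cauchy G.
  apply: cauchy_exP => eps eps0.
  have epsE : eps = (complex.Re eps)%:C by rewrite RRe_real// gtr0_real.
  set d := complex.Re eps in epsE; have d0 : 0 < d by rewrite -ltcR -epsE.
  have d20 : 0 < d ^+ 2 / 4 by rewrite divr_gt0 ?exprn_gt0.
  have [x xd] := m_approx d20.
  (* Two points of this sublevel set are at squared distance below d ^+ 2. *)
  exists x, (d ^+ 2 / 4) => //= y yd.
  rewrite -ball_normE /= normr_renorm epsE ltcR.
  rewrite -(@ltr_pXn2r _ 2)// ?nnegrE ?renorm_ge0 ?(ltW d0)//.
  by rewrite (lt_le_trans (F_parallelogram xd yd))// mulrC divfK ?pnatr_eq0.
exists z => v; apply/eqP; rewrite eq_sym -subr_eq0 -sqrf_eq0.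
rewrite eq_le sqr_ge0 andbT.
apply/ler_addgt0Pr => e e0; rewrite add0r.
pose N := renorm v ^+ 2; have N0 : 0 <= N by exact: sqr_ge0.
(* With q ^+ 2 <= N * d and p ^+ 2 <= d * N below, (p + q) ^+ 2 is at most
   4 * N * d, which this choice of d makes at most e. *)
pose d := Num.min 1 (e / (4 * (N + 1))).
have N1 : 0 < 4 * (N + 1) by lra.
have d0 : 0 < d by rewrite lt_min ltr01 divr_gt0.
have d1 : d <= 1 by rewrite ge_min lexx.
have dN : 4 * (N + 1) * d <= e by rewrite mulrC -ler_pdivlMr// ge_min lexx orbT.
have [x [zx xm]] : exists x, ball z d%:C x /\ F x < m + d.
  apply: (@filter_ex _ G); apply: filterI.
  - by apply: Gz; apply: nbhsx_ballx; rewrite ltcR.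
  - by exists d.
have h1 := near_stationary v xm.
have h2 := reinner_cauchy_schwarz_sqr v (z - x).
have h3 : renorm (z - x) ^+ 2 <= d ^+ 2.
  move: zx; rewrite -ball_normE /= normr_renorm ltcR => /ltW zx.
  by rewrite ler_pXn2r// ?nnegrE ?renorm_ge0 ?(ltW d0).
have -> : reinner v z - f v = (reinner v x - f v) + reinner v (z - x).
  by rewrite addrAC -reinnerDr addrCA subrr addr0.
set p := _ - f v in h1 *; set q := reinner v _ in h2 *.
have q2 : q ^+ 2 <= N * d.
  rewrite (le_trans h2)// ler_wpM2l// (le_trans h3)// expr2 ler_piMl//.
  exact: ltW.
have := sqr_ge0 (p - q); rewrite -/N in h1; nra.
Qed.

End RealRiesz.

Section Adjoint.
Context {R : realType}.
Implicit Types H K L : hilbertType R.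

Lemma inner_inj H (u v : H) : (forall x, inner x u = inner x v) -> u = v.
Proof.
move=> uv; apply/eqP; rewrite -subr_eq0 -normr_eq0 -sqrf_eq0 normr_inner.
by rewrite linearBr /= uv subrr.
Qed.

(** Real parts determine a complex linear functional: the imaginary part of
f x is minus the real part of f (i x). *)
Lemma riesz H (f : H -> R[i]) (k : R) :
  (forall a x y, f (a *: x + y) = a * f x + f y) ->
  (forall x, complex.Re (f x) <= k * renorm x) ->
  exists z, forall x, f x = inner x z.
Proof.
move=> flin fk.
have f0 : f 0 = 0.
  by apply: (addrI (f 0)); rewrite addr0 -[X in X + _]mul1r -flin scale1r addr0.
have fD x y : f (x + y) = f x + f y by rewrite -[x]scale1r flin mul1r scale1r.
have fZ a x : f (a *: x) = a * f x by rewrite -[a *: x]addr0 flin f0 addr0.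
have [|t x|x|z fz] := @real_riesz R H (fun x => complex.Re (f x)) k.
- by move=> x y; rewrite fD raddfD.
- by rewrite fZ; case: (f x) => u v /=; rewrite mul0r subr0.
- rewrite ler_norml fk andbT -lerN2 opprK.
  have := fk ((-1) *: x).
  by rewrite fZ /renorm normrZ normrN1 mul1r mulN1r raddfN.
exists z => x; have := fz x; have := fz ('i%C *: x).
rewrite /reinner innerZl fZ.
case: (f x) (inner x z) => [u v] [u' v'] /=; rewrite !mul0r !mul1r !sub0r.
by move=> /oppr_inj -> ->.
Qed.

Lemma reinner_bop_le H K (T : bop H K) x y :
  reinner (T x) y <= opnorm T * renorm x * renorm y.
Proof.
apply: (le_trans (reinner_cauchy_schwarz _ _)); rewrite ler_wpM2r ?renorm_ge0//.
by rewrite -lecR rmorphM /= -!normr_renorm le_opnorm.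
Qed.

Lemma adjoint_exists H K (T : bop H K) : exists S, is_adjoint T S.
Proof.
have repr y : exists z, forall x, inner (T x) y = inner x z.
  apply: (@riesz _ _ (opnorm T * renorm y)) => [a x x'|x].
    by rewrite linearP innerDl innerZl.
  by rewrite mulrAC; exact: reinner_bop_le.
pose S y := projT1 (cid (repr y)).
have SP x y : inner (T x) y = inner x (S y) by exact: (projT2 (cid (repr y))).
have bS : S \in @bounded_op R K H.
  rewrite inE; split => [a y y'|].
    by apply: inner_inj => x; rewrite -SP !linearDr/= !linearZr_LR/= !SP.
  exists (opnorm T) => y; rewrite !normr_renorm -rmorphM lecR.
  have [->|Sy0] := eqVneq (renorm (S y)) 0.
    by rewrite mulr_ge0 ?opnorm_ge0 ?renorm_ge0.
  have Sy : 0 < renorm (S y) by rewrite lt_def Sy0 renorm_ge0.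
  (* |S y|^2 = <T (S y), y>, and one factor |S y| cancels. *)
  rewrite -(@ler_pM2r _ (renorm (S y)))// -expr2 -reinnerxx /reinner -SP.
  by rewrite mulrAC; exact: reinner_bop_le.
by exists (BOp bS) => x y; rewrite SP.
Qed.

Definition adj H K (T : bop H K) : bop K H := projT1 (cid (adjoint_exists T)).

Lemma adjP H K (T : bop H K) : is_adjoint T (adj T).
Proof. exact: (projT2 (cid (adjoint_exists T))). Qed.

Lemma adj_eq H K (T : bop H K) S : is_adjoint T S -> S = adj T.
Proof.
by move=> TS; apply: bopP => y; apply: inner_inj => x; rewrite -TS -adjP.
Qed.

Lemma adjK H K : cancel (@adj H K) (@adj K H).
Proof.
by move=> T; apply/esym/adj_eq => x y; rewrite innerC -adjP -innerC.
Qed.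

Lemma adjoint_setE H K (M : set (bop H K)) :
  adjoint_set M = [set adj T | T in M].
Proof.
apply/seteqP; split => [S [T MT /adj_eq ->]|_ [T MT <-]]; first by exists T.
by exists T => //; exact: adjP.
Qed.

Lemma adjoint_setP H K (M : set (bop H K)) S : adjoint_set M S <-> M (adj S).
Proof.
rewrite adjoint_setE; split => [[T MT <-]|MS]; first by rewrite adjK.
by exists (adj S) => //; rewrite adjK.
Qed.

Lemma adjoint_setK H K (M : set (bop H K)) : adjoint_set (adjoint_set M) = M.
Proof.
by apply/seteqP; split=> S; rewrite !adjoint_setP adjK.
Qed.

Lemma adj_linear H K (a : R[i]) (S T : bop H K) :
  adj (a *: S + T) = a^*%C *: adj S + adj T.
Proof.
apply/esym/adj_eq => x y.
change (inner (a *: S x + T x) y = inner x (a^*%C *: adj S y + adj T y)).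
rewrite innerDl innerZl linearDr/= linearZr_LR/= !adjP; congr (_ * _ + _).
exact/esym/conjCK.
Qed.

Lemma adj0 H K : adj (0 : bop H K) = 0.
Proof. by apply/esym/adj_eq => x y; rewrite !linear0l linear0r. Qed.

Lemma adj_comp H K L (S : bop K L) (T : bop H K) :
  adj (S ** T) = adj T ** adj S.
Proof. by apply/esym/adj_eq => x y; rewrite /= !adjP. Qed.

Lemma bop_id_subproof H : idfun \in @bounded_op R H H.
Proof. by rewrite inE; split => //; exists 1 => x; rewrite mul1r. Qed.

Definition bop_id H : bop H H := BOp (bop_id_subproof H).

Lemma adj_id H : adj (bop_id H) = bop_id H.
Proof. exact/esym/adj_eq. Qed.

Lemma bop_compA H K L L' (S : bop L L') (T : bop K L) (U : bop H K) :
  S ** (T ** U) = S ** T ** U.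
Proof. exact: bopP. Qed.

Lemma bop_comp1l H K (T : bop H K) : bop_id K ** T = T.
Proof. exact: bopP. Qed.

Lemma bop_comp1r H K (T : bop H K) : T ** bop_id H = T.
Proof. exact: bopP. Qed.

Lemma bop_compPl H K L (S : bop K L) a (T U : bop H K) :
  S ** (a *: T + U) = a *: (S ** T) + S ** U.
Proof.
apply: bopP => x; change (S (a *: T x + U x) = a *: S (T x) + S (U x)).
exact: linearP.
Qed.

Lemma bop_compPr H K L (S : bop H K) a (T U : bop K L) :
  (a *: T + U) ** S = a *: (T ** S) + U ** S.
Proof. exact: bopP. Qed.

Lemma bop_comp0r H K L (S : bop K L) : S ** (0 : bop H K) = 0.
Proof. by apply: bopP => x; exact: linear0. Qed.

Lemma bop_comp0l H K L (S : bop H K) : (0 : bop K L) ** S = 0.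
Proof. exact: bopP. Qed.

Lemma opnorm_comp H K L (S : bop K L) (T : bop H K) :
  opnorm (S ** T) <= opnorm S * opnorm T.
Proof.
apply: opnorm_le => [|x]; first by rewrite mulr_ge0 ?opnorm_ge0.
rewrite rmorphM /= -mulrA (le_trans (le_opnorm _ _))// ler_wpM2l ?le_opnorm//.
by rewrite ler0c opnorm_ge0.
Qed.

End Adjoint.

(** * Closed spans *)

Lemma closure_sub_preimage (V W : topologicalType) (X : set V) (Y : set W)
    (f : V -> W) :
  continuous f -> closed Y -> X `<=` f @^-1` Y -> closure X `<=` f @^-1` Y.
Proof.
move=> fc Yc XY.
have /closure_id -> : closed (f @^-1` Y).
  by apply: preimage_closed => // x _; exact: fc.
exact: closureS.
Qed.

(** One vector at a time: with u in L fixed, v |-> a u + v maps L into L and so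
the closure into the closure; then the same with v fixed in the closure. *)
Lemma closure_linear (K : numFieldType) (V : normedModType K) (L : set V) :
  (forall a x y, L x -> L y -> L (a *: x + y)) ->
  forall a x y, closure L x -> closure L y -> closure L (a *: x + y).
Proof.
move=> Llin a x y Lx Ly.
have closure_r u : L u ->
    closure L `<=` (fun v => a *: u + v) @^-1` closure L.
  move=> Lu; apply: closure_sub_preimage.
  - by move=> v; apply: cvgD; [exact: cvg_cst|exact: cvg_id].
  - exact: closed_closure.
  - by move=> v Lv; apply: subset_closure; exact: Llin.
suff : closure L `<=` (fun u => a *: u + y) @^-1` closure L by exact.
apply: closure_sub_preimage.
- by move=> v; apply: cvgD; [exact: scaler_continuous|exact: cvg_cst].
- exact: closed_closure.
- by move=> u Lu; exact: closure_r.
Qed.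

Section Span.
Context {R : realType}.
Implicit Types H K L : hilbertType R.

Lemma linear_subspaceP H K (M : set (bop H K)) :
  linear_subspace M <->
  M 0 /\ forall a S T, M S -> M T -> M (a *: S + T).
Proof.
rewrite /linear_subspace /submod_closed; split => -[].
  rewrite inE => M0 Mlin; split=> // a S T MS MT.
  by have := Mlin a S T; rewrite !inE; apply.
by move=> M0 Mlin; split => [|a S T]; rewrite ?inE => // MS MT; exact: Mlin.
Qed.

Lemma lin_span_subspace H K (X : set (bop H K)) : linear_subspace (lin_span X).
Proof.
apply/linear_subspaceP; split.
  by exists 0, (fun=> 0), (fun=> 0); split; [case|rewrite big_ord0].
move=> a S T [m [c [s [Xs ->]]]] [n [d [t [Xt ->]]]].
exists (m + n)%N,
  (fun i => match fintype.split i with inl j => a * c j | inr j => d j end),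
  (fun i => match fintype.split i with inl j => s j | inr j => t j end).
split; first by move=> i; case: fintype.split.
rewrite big_split_ord scaler_sumr; congr (_ + _); apply: eq_bigr => i _.
  by rewrite -[lshift n i]/(fintype.unsplit (inl i)) unsplitK scalerA.
by rewrite -[rshift m i]/(fintype.unsplit (inr i)) unsplitK.
Qed.

Lemma sub_lin_span H K (X : set (bop H K)) : X `<=` lin_span X.
Proof.
move=> T XT; exists 1%N, (fun=> 1), (fun=> T); split=> //.
by rewrite big_ord1 scale1r.
Qed.

Lemma lin_span_min H K (X Y : set (bop H K)) :
  linear_subspace Y -> X `<=` Y -> lin_span X `<=` Y.
Proof.
move=> /linear_subspaceP[Y0 Ylin] XY _ [n [c [s [Xs ->]]]].
elim/big_rec: _ => // i T _ YT; apply: Ylin => //; exact: XY.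
Qed.

Definition closed_subspace H K (Y : set (bop H K)) :=
  linear_subspace Y /\ closed Y.

Lemma closed_span_min H K (X Y : set (bop H K)) :
  closed_subspace Y -> X `<=` Y -> closed_span X `<=` Y.
Proof.
move=> [Ylin Yc] XY; rewrite (proj1 (closure_id Y) Yc) /closed_span.
by apply: closureS; exact: lin_span_min.
Qed.

Lemma sub_closed_span H K (X : set (bop H K)) : X `<=` closed_span X.
Proof. by move=> T /sub_lin_span; exact: subset_closure. Qed.

Lemma closed_span_subspace H K (X : set (bop H K)) :
  closed_subspace (closed_span X).
Proof.
have /linear_subspaceP[X0 Xlin] := lin_span_subspace X.
split; last exact: closed_closure.
apply/linear_subspaceP; split; first exact: subset_closure.
exact: closure_linear.
Qed.

(** The operators that a bounded linear map sends into Y form a closed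
subspace; with the minimality of closed spans this reduces inclusions to
generators. *)
Lemma bounded_closed_preimage H K H' K' (f : bop H K -> bop H' K') (k : R) Y :
  (forall a S T, f (a *: S + T) = a *: f S + f T) ->
  (forall T, opnorm (f T) <= k * opnorm T) ->
  closed_subspace Y -> closed_subspace (f @^-1` Y).
Proof.
move=> flin fk [/linear_subspaceP[Y0 Ylin] Yc].
have f0 : f 0 = 0.
  apply: (addrI (f 0)); rewrite addr0.
  by have := flin 1 0 0; rewrite !scale1r addr0.
split.
  apply/linear_subspaceP; split; first by rewrite /= f0.
  by move=> a S T YS YT; rewrite /= flin; exact: Ylin.
apply: preimage_closed => // T _.
apply/(@cvgrPdist_lt _ _ _ (nbhs T)) => e e0.
have k1 : 0 < (`|k| + 1)%:C :> R[i] by rewrite ltcR ltr_wpDl.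
near=> S.
have TS : `|T - S| < e / (`|k| + 1)%:C.
  by near: S; apply: cvgr_dist_lt => //; rewrite divr_gt0.
have -> : f T - f S = f (T - S).
  by have := flin (-1) S T; rewrite !scaleN1r ![- _ + _]addrC => ->.
move: TS; rewrite ltr_pdivlMr//; apply: le_lt_trans.
change ((opnorm (f (T - S)))%:C <= (opnorm (T - S))%:C * (`|k| + 1)%:C :> R[i]).
rewrite -rmorphM lecR (le_trans (fk _))// mulrC ler_wpM2l ?opnorm_ge0//.
by rewrite (le_trans (ler_norm k))// lerDl.
Unshelve. all: by end_near. Qed.

End Span.

(** * Compressions by sets of operators *)

Section Compression.
Context {R : realType}.
Implicit Types H K L : hilbertType R.

Lemma closed_subspace_lmul H K L (S : bop K L) (Y : set (bop H L)) :
  closed_subspace Y -> closed_subspace [set T | Y (S ** T)].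
Proof.
apply: (@bounded_closed_preimage _ _ _ _ _ (bop_comp S) (opnorm S)).
  by move=> *; exact: bop_compPl.
by move=> T; exact: opnorm_comp.
Qed.

Lemma closed_subspace_rmul H K L (S : bop H K) (Y : set (bop H L)) :
  closed_subspace Y -> closed_subspace [set T | Y (T ** S)].
Proof.
apply: (@bounded_closed_preimage _ _ _ _ _ (fun T => T ** S) (opnorm S)).
  by move=> *; exact: bop_compPr.
by move=> T; rewrite mulrC; exact: opnorm_comp.
Qed.

(** [M^* B M], the form in which both equations of a strong TRO equivalence
are used: [M A M^*] is the compression of A by M^*. *)
Definition compress H K (M : set (bop H K)) (B : set (bop K K)) :
    set (bop H H) :=
  closed_span (prod_set (prod_set (adjoint_set M) B) M).

Lemma mem_compress H K (M : set (bop H K)) B S T b :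
  M S -> M T -> B b -> compress M B (adj S ** b ** T).
Proof.
move=> MS MT Bb; apply: sub_closed_span.
exists (adj S ** b); last by exists T.
by exists (adj S); [exists S => //; exact: adjP|exists b].
Qed.

Lemma compress_min H K (M : set (bop H K)) B Y :
  closed_subspace Y ->
  (forall S T b, M S -> M T -> B b -> Y (adj S ** b ** T)) ->
  compress M B `<=` Y.
Proof.
move=> Yc MY; apply: closed_span_min => // _ [_ [S' MS' [b Bb <-]] [T MT <-]].
by move: MS'; rewrite adjoint_setE => -[S MS <-]; exact: MY.
Qed.

Lemma compress_subspace H K (M : set (bop H K)) B :
  closed_subspace (compress M B).
Proof. exact: closed_span_subspace. Qed.

(** S^* b T is conjugate linear in S and linear in T, so that replacing M by its
span adds nothing to the closed span. *)
Lemma compress_lin_span H K (M : set (bop H K)) B :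
  compress (lin_span M) B = compress M B.
Proof.
have [/linear_subspaceP[Z0 Zlin] _] := compress_subspace M B.
apply/seteqP; split; last first.
  apply: compress_min; first exact: compress_subspace.
  by move=> S T b MS MT Bb; apply: mem_compress => //; exact: sub_lin_span.
apply: compress_min => [|S T b MS MT Bb]; first exact: compress_subspace.
move: T MT; apply: lin_span_min.
  apply/linear_subspaceP; split=> [|a T T' /= MT MT'].
    by rewrite /= bop_comp0r.
  by rewrite bop_compPl; exact: Zlin.
move=> T MT; move: S MS; apply: lin_span_min; last first.
  by move=> S MS; exact: mem_compress.
apply/linear_subspaceP; split=> [|a S S' /= MS MS'].
  by rewrite /= adj0 !bop_comp0l.
by rewrite adj_linear !bop_compPr; exact: Zlin.
Qed.

(** * Adjoint sets and ternary rings of operators *)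

Lemma adjoint_set_prod H K L (M : set (bop K L)) (N : set (bop H K)) :
  adjoint_set (prod_set M N) = prod_set (adjoint_set N) (adjoint_set M).
Proof.
rewrite !adjoint_setE; apply/seteqP; split.
  move=> _ [_ [S MS [T NT <-]] <-]; rewrite adj_comp.
  by exists (adj T); [exists T|exists (adj S) => //; exists S].
move=> _ [_ [T NT <-] [_ [S MS <-] <-]]; rewrite -adj_comp.
by exists (S ** T) => //; exists S => //; exists T.
Qed.

Lemma prod_setA H K L L' (M : set (bop L L')) (N : set (bop K L))
    (P : set (bop H K)) :
  prod_set M (prod_set N P) = prod_set (prod_set M N) P.
Proof.
apply/seteqP; split.
  move=> _ [S MS [_ [T NT [U PU <-]] <-]]; rewrite bop_compA.
  by exists (S ** T); [exists S => //; exists T|exists U].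
move=> _ [_ [S MS [T NT <-]] [U PU <-]]; rewrite -bop_compA.
by exists S => //; exists (T ** U) => //; exists T => //; exists U.
Qed.

Lemma adjoint_set_subspace H K (M : set (bop H K)) :
  linear_subspace M -> linear_subspace (adjoint_set M).
Proof.
move=> /linear_subspaceP[M0 Mlin]; apply/linear_subspaceP; split.
  by rewrite adjoint_setP adj0.
move=> a S T /adjoint_setP MS /adjoint_setP MT; apply/adjoint_setP.
by rewrite adj_linear; exact: Mlin.
Qed.

Lemma adjoint_setS H K (M N : set (bop H K)) :
  M `<=` N -> adjoint_set M `<=` adjoint_set N.
Proof. by move=> MN S /adjoint_setP/MN ?; exact/adjoint_setP. Qed.

Lemma adjoint_set_lin_span H K (M : set (bop H K)) :
  adjoint_set (lin_span M) = lin_span (adjoint_set M).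
Proof.
have span_sub H' K' (N : set (bop H' K')) :
    lin_span (adjoint_set N) `<=` adjoint_set (lin_span N).
  apply: lin_span_min; first exact/adjoint_set_subspace/lin_span_subspace.
  exact/adjoint_setS/sub_lin_span.
apply/seteqP; split=> [|//].
rewrite -[X in _ `<=` X]adjoint_setK; apply: adjoint_setS.
by rewrite -[X in lin_span X]adjoint_setK; exact: span_sub.
Qed.

Lemma TROP H K (M : set (bop H K)) :
  TRO M <-> linear_subspace M /\
    forall S T U, M S -> M T -> M U -> M (S ** adj T ** U).
Proof.
split=> -[Mlin MM]; split=> //.
  move=> S T U MS MT MU; apply: MM; exists (S ** adj T); last by exists U.
  by exists S => //; exists (adj T) => //; apply/adjoint_setP; rewrite adjK.
move=> _ [_ [S MS [T' MT <-]] [U MU <-]].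
by move: MT; rewrite adjoint_setE => -[T MT <-]; exact: MM.
Qed.

(** The ternary product is linear or conjugate linear in each argument, so
closedness under it passes to spans. *)
Lemma TRO_lin_span H K (M : set (bop H K)) :
  (forall S T U, M S -> M T -> M U -> M (S ** adj T ** U)) ->
  TRO (lin_span M).
Proof.
move=> MM; apply/TROP; split; first exact: lin_span_subspace.
have /linear_subspaceP[Z0 Zlin] := lin_span_subspace M.
move=> S T U MS MT; move: U; apply: lin_span_min.
  apply/linear_subspaceP; split=> [|a U U' /= ? ?].
    by rewrite /= ?(adj0, bop_comp0l, bop_comp0r).
  by rewrite bop_compPl; exact: Zlin.
move=> U MU; move: T MT; apply: lin_span_min.
  apply/linear_subspaceP; split=> [|a T T' /= ? ?].
    by rewrite /= ?(adj0, bop_comp0l, bop_comp0r).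
  by rewrite adj_linear bop_compPl bop_compPr; exact: Zlin.
move=> T MT; move: S MS; apply: lin_span_min.
  apply/linear_subspaceP; split=> [|a S S' /= ? ?].
    by rewrite /= ?(adj0, bop_comp0l, bop_comp0r).
  by rewrite !bop_compPr; exact: Zlin.
by move=> S MS; apply: sub_lin_span; exact: MM.
Qed.

Lemma TRO_adjoint_set H K (M : set (bop H K)) : TRO M -> TRO (adjoint_set M).
Proof.
move=> /TROP[Mlin MM]; apply/TROP; split; first exact: adjoint_set_subspace.
move=> S T U /adjoint_setP MS /adjoint_setP MT /adjoint_setP MU.
apply/adjoint_setP; rewrite !adj_comp bop_compA; exact: MM.
Qed.

(** * Composing two links *)

(** Quantifying over all multipliers, rather than generating an algebra from
M M^* and N^* N, makes the unit and stability under products and adjoints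
immediate. *)
Definition multiplier_star H (B : set (bop H H)) : set (bop H H) :=
  [set d | forall b, B b ->
    [/\ B (d ** b), B (b ** d), B (adj d ** b) & B (b ** adj d)]].

Lemma multiplier_star_id H (B : set (bop H H)) : multiplier_star B (bop_id H).
Proof. by move=> b Bb; rewrite adj_id bop_comp1l bop_comp1r. Qed.

Lemma multiplier_star_adj H (B : set (bop H H)) d :
  multiplier_star B d -> multiplier_star B (adj d).
Proof. by move=> Bd b /Bd[? ? ? ?]; rewrite adjK. Qed.

Lemma multiplier_star_comp H (B : set (bop H H)) d e :
  multiplier_star B d -> multiplier_star B e -> multiplier_star B (d ** e).
Proof.
move=> Bd Be b Bb; rewrite adj_comp.
have [db bd adb bad] := Bd _ Bb; have [eb be aeb bae] := Be _ Bb.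
have [deb _ _ _] := Bd _ eb; have [_ bde _ _] := Be _ bd.
have [_ _ aeadb _] := Be _ adb; have [_ _ _ baead] := Bd _ bae.
by rewrite -!bop_compA in bde baead *; split.
Qed.

Lemma adjoint_set_multiplier_star H (B : set (bop H H)) :
  adjoint_set (multiplier_star B) = multiplier_star B.
Proof.
apply/seteqP; split=> d; rewrite adjoint_setP; last exact: multiplier_star_adj.
by move/multiplier_star_adj; rewrite adjK.
Qed.

(** S^* T is absorbed by the generators U^* b V of the compression:
S^* T U^* b V = (U T^* S)^* b V and U^* b V S^* T = U^* b (V S^* T), where
U T^* S and V S^* T are in M.  As T^* S has the same form as S^* T,
its adjoint multiplies as well. *)
Lemma TRO_multiplier_star H K (M : set (bop H K)) B :
  TRO M -> forall S T, M S -> M T ->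
  multiplier_star (compress M B) (adj S ** T).
Proof.
move=> /TROP[_ MM].
have left_mul S T : M S -> M T ->
    compress M B `<=` [set b | compress M B (adj S ** T ** b)].
  move=> MS MT; apply: compress_min.
    exact/closed_subspace_lmul/compress_subspace.
  move=> U V b MU MV Bb /=.
  have -> : adj S ** T ** (adj U ** b ** V) = adj (U ** adj T ** S) ** b ** V.
    by rewrite !adj_comp adjK !bop_compA.
  by apply: mem_compress => //; exact: MM.
have right_mul S T : M S -> M T ->
    compress M B `<=` [set b | compress M B (b ** (adj S ** T))].
  move=> MS MT; apply: compress_min.
    exact/closed_subspace_rmul/compress_subspace.
  move=> U V b MU MV Bb /=.
  have -> : adj U ** b ** V ** (adj S ** T) = adj U ** b ** (V ** adj S ** T).
    by rewrite !bop_compA.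
  by apply: mem_compress => //; exact: MM.
move=> S T MS MT b Bb; rewrite adj_comp adjK.
by split; [exact: left_mul|exact: right_mul|exact: left_mul|exact: right_mul].
Qed.

(** Inserting the multipliers of B between N and M leaves the two-step
compression unchanged: they are absorbed by B = [N^* C N], and the identity is
among them. *)
Lemma compress_link H K L (M : set (bop H K)) (N : set (bop K L))
    (C : set (bop L L)) :
  let B := compress N C in
  compress (prod_set (prod_set N (multiplier_star B)) M) C = compress M B.
Proof.
move=> B; set D := multiplier_star B; apply/seteqP; split.
  apply: compress_min; first exact: compress_subspace.
  move=> _ _ c [_ [n Nn [d Dd <-]] [m Mm <-]]
    [_ [n' Nn' [d' Dd' <-]] [m' Mm' <-]] Cc.
  have -> : adj (n ** d ** m) ** c ** (n' ** d' ** m') =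
      adj m ** (adj d ** (adj n ** c ** n') ** d') ** m'.
    by rewrite !adj_comp !bop_compA.
  apply: mem_compress => //.
  have Bnn : B (adj n ** c ** n') by exact: mem_compress.
  have [_ _ Bd _] := Dd _ Bnn.
  by have [_ ? _ _] := Dd' _ Bd.
apply: compress_min => [|m m' b Mm Mm' Bb]; first exact: compress_subspace.
move: b Bb; apply: compress_min.
  have Ym' := closed_subspace_rmul m'
    (compress_subspace (prod_set (prod_set N D) M) C).
  exact: (closed_subspace_lmul (adj m) Ym').
move=> n n' c Nn Nn' Cc /=.
have -> : adj m ** (adj n ** c ** n') ** m' =
    adj (n ** bop_id K ** m) ** c ** (n' ** bop_id K ** m').
  by rewrite !bop_comp1r !adj_comp !bop_compA.
have N1M u v : N u -> M v -> prod_set (prod_set N D) M (u ** bop_id K ** v).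
  move=> Nu Mv; exists (u ** bop_id K); last by exists v.
  by exists u => //; exists (bop_id K) => //; exact: multiplier_star_id.
by apply: mem_compress => //; exact: N1M.
Qed.

Lemma strongly_TRO_equivalentE (A B : opalg R) :
  strongly_TRO_equivalent A B <->
  exists M : set (bop (opalg_space A) (opalg_space B)),
    [/\ TRO M, A = compress M B :> set _ &
        B = compress (adjoint_set M) A :> set _].
Proof.
split=> -[M [MT AB BA]]; exists M; split=> //.
  by rewrite /compress adjoint_setK.
by move: BA; rewrite /compress adjoint_setK.
Qed.

End Compression.

Theorem theorem2p1 (R : realType) :
  RelationClasses.Equivalence (@strongly_TRO_equivalent R).
Proof.
split.
- move=> A; apply/strongly_TRO_equivalentE; exists (lin_span [set bop_id _]).
  have adj1 : adjoint_set [set bop_id (opalg_space A)] = [set bop_id _].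
    by rewrite adjoint_setE image_set1 adj_id.
  have [Alin _ Acl] := opalg_closed_algebra A.
  have A1 : A = compress [set bop_id _] A :> set _.
    apply/seteqP; split=> [a Aa|].
      have <- : adj (bop_id _) ** a ** bop_id _ = a.
        by rewrite adj_id bop_comp1l bop_comp1r.
      exact: mem_compress.
    apply: compress_min => // _ _ a -> -> Aa.
    by rewrite adj_id bop_comp1l bop_comp1r.
  split; last 2 first.
  - by rewrite compress_lin_span.
  - by rewrite adjoint_set_lin_span adj1 compress_lin_span.
  apply: TRO_lin_span => _ _ _ -> -> ->.
  by rewrite adj_id !bop_comp1l.
- move=> A B /strongly_TRO_equivalentE[M [MT AE BE]].
  apply/strongly_TRO_equivalentE; exists (adjoint_set M).
  by rewrite adjoint_setK; split=> //; exact: TRO_adjoint_set.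
- move=> A B C /strongly_TRO_equivalentE[M [MT AB BA]]
    /strongly_TRO_equivalentE[N [NT BC CB]].
  apply/strongly_TRO_equivalentE.
  set D := multiplier_star B.
  exists (lin_span (prod_set (prod_set N D) M)).
  split.
  + apply: TRO_lin_span => _ _ _ [_ [n1 Nn1 [d1 Dd1 <-]] [m1 Mm1 <-]]
      [_ [n2 Nn2 [d2 Dd2 <-]] [m2 Mm2 <-]] [_ [n3 Nn3 [d3 Dd3 <-]] [m3 Mm3 <-]].
    (* The product is n1 * d * m3, where d collects the five middle factors. *)
    have DM : D (m1 ** adj m2).
      rewrite /D BA -[m1]adjK; apply: TRO_multiplier_star.
      * exact: TRO_adjoint_set.
      * by apply/adjoint_setP; rewrite adjK.
      * by apply/adjoint_setP; rewrite adjK.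
    have DN : D (adj n2 ** n3) by rewrite /D BC; exact: TRO_multiplier_star.
    exists (n1 ** (d1 ** (m1 ** adj m2) ** adj d2 ** (adj n2 ** n3) ** d3)).
      exists n1 => //; eexists; last reflexivity.
      have Dd2' : D (adj d2) by exact: multiplier_star_adj.
      by do 4! [apply: multiplier_star_comp => //].
    by exists m3 => //; rewrite !adj_comp !bop_compA.
  + by rewrite compress_lin_span /D BC compress_link -BC.
  + rewrite adjoint_set_lin_span compress_lin_span !adjoint_set_prod.
    by rewrite adjoint_set_multiplier_star prod_setA /D BA compress_link -BA.
Qed.
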